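(* Let $d\ge1$, $h>0$ and let $u\in\ell^2((h\mathbb Z)^d)$ be a solution to $\Delta_{\mathrm d}u_j+V_ju_j=0$ for all $j\in\mathbb Z^d$, where $V$ is a bounded potential on $(h\mathbb Z)^d$ and $\|V\|_\infty$, $\|u\|_{\ell^2}$ are finite and independent of $h$. \begin{enumerate} \item There exists $\mu_0=\mu_0(d)$ such that if $h^d\sum_{j\in\mathbb Z^d}e^{\mu_0|jh|^{4/3}}|u_j|^2<\infty$ uniformly with respect to $h$, then there exists $h_0>0$ such that $h\in(0,h_0)$ implies $u\equiv0$. \item There exists $\mu_0=\mu_0(d)$ such that if, for some $\beta>3$, $h^d\sum_{j\in\mathbb Z^d}e^{\mu_0|jh|^{1+1/\beta}\log|jh|}|u_j|^2<\infty$ uniformly with respect to $h$, then there exists $h_0>0$ such that $h\in(0,h_0)$ implies $u\equiv0$. \item There exists $\mu_0=\mu_0(d)$ such that if $h^d\sum_{j\in\mathbb Z^d}e^{\mu_0|j|\log(|j|h)}|u_j|^2<\infty$, then $u\equiv0$. \end{enumerate}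
   Context: For $h>0$, functions on $(h\mathbb Z)^d$ are indexed by $j\in\mathbb Z^d$ via $f_j=f(hj)$. The discrete Laplacian is $\Delta_{\mathrm d}f_j:=h^{-2}\sum_{k=1}^d(f_{j+e_k}-2f_j+f_{j-e_k})$. $\|u\|_{\ell^2}=(h^d\sum_j|u_j|^2)^{1/2}$, $\|V\|_\infty=\sup_j|V_j|$, and $|\cdot|$ is the Euclidean norm. *)

(* Defs.v *)
From mathcomp Require Import all_boot all_order all_algebra.
From mathcomp Require Import all_classical all_reals all_analysis.
From mathcomp Require Export complex.
Set Implicit Arguments. Unset Strict Implicit. Unset Printing Implicit Defensive.
Import Order.TTheory GRing.Theory Num.Theory.
Local Open Scope ring_scope.

(* Lattice points j in Z^d; the grid point is h*j in (hZ)^d. *)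
Definition pt (d : nat) := {ffun 'I_d -> int}.

Definition shiftp (d : nat) (j : pt d) (k : 'I_d) : pt d :=
  [ffun i => j i + (i == k)%:Z].
Definition shiftm (d : nat) (j : pt d) (k : 'I_d) : pt d :=
  [ffun i => j i - (i == k)%:Z].

Definition eucl (R : realType) (d : nat) (j : pt d) : R :=
  Num.sqrt (\sum_(i < d) ((j i)%:~R : R) ^+ 2).

Definition cabs2 (R : realType) (z : R[i]) : R :=
  complex.Re z ^+ 2 + complex.Im z ^+ 2.
Definition cabs (R : realType) (z : R[i]) : R := Num.sqrt (cabs2 z).

Definition dlap (R : realType) (d : nat) (h : R) (u : pt d -> R[i]) (j : pt d)
  : R[i] :=
  ((h ^- 2)%:C)%C * \sum_(k < d) (u (shiftp j k) - 2%:R * u j + u (shiftm j k)).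

Definition wsum (R : realType) (d : nat) (h : R) (w : pt d -> R)
  (u : pt d -> R[i]) : \bar R :=
  (\esum_(j in [set: pt d]) ((h ^+ d * w j * cabs2 (u j))%:E))%E.

Definition l2sq (R : realType) (d : nat) (h : R) (u : pt d -> R[i]) : \bar R :=
  wsum h (fun _ => 1) u.

(* Main.v *)
(** For fixed [h] the equation expresses the value of [u] at [i - e_k] through
    values on the half-space [{x_k >= i_k}]. Hence the supremum of [|u|] grows
    by at most a factor [C = 4 d + h^2 K] each time the half-space is enlarged
    by one layer, so [|u j| <= C^n sup {|u p| : p_k >= j_k + n}] for all [n].
    All three weights dominate [exp (c |hj| ln |hj|)] for some [c > 0]; for
    fixed [h] they force [u] to decay faster than every [exp (- A |j|)], which
    beats [C^n], and so [u = 0] for every [h > 0]. *)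
Require Import Defs.
From mathcomp Require Import all_boot all_order all_algebra.
From mathcomp Require Import all_classical all_reals all_analysis.
From mathcomp Require Import complex ring lra.
Import Order.TTheory GRing.Theory Num.Theory.
Local Open Scope ring_scope.

(** * The modulus on [R[i]] as an absolute value *)

Section Cabs.
Context {R : realType}.
Implicit Types z w : R[i].

Lemma cabsE z : cabs z = Normc.normc z.
Proof. by case: z. Qed.

Lemma cabs_ge0 z : 0 <= cabs z.
Proof. exact: sqrtr_ge0. Qed.

Lemma cabs2E z : cabs2 z = cabs z ^+ 2.
Proof. by rewrite sqr_sqrtr // addr_ge0 ?sqr_ge0. Qed.

Lemma cabs_eq0 z : cabs z = 0 -> z = 0.
Proof. by rewrite cabsE => /Normc.eq0_normc. Qed.

Lemma cabs0 : cabs (0 : R[i]) = 0.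
Proof. by rewrite cabsE Normc.normc0. Qed.

Lemma cabsM z w : cabs (z * w) = cabs z * cabs w.
Proof. by rewrite !cabsE Normc.normcM. Qed.

Lemma cabsN z : cabs (- z) = cabs z.
Proof. by rewrite !cabsE; exact: normcN. Qed.

Lemma le_cabsD z w : cabs (z + w) <= cabs z + cabs w.
Proof. by rewrite !cabsE; exact: le_normcD. Qed.

Lemma cabs_real (x : R) : cabs (x%:C)%C = `|x|.
Proof. by rewrite cabsE /= expr0n addr0 sqrtr_sqr. Qed.

Lemma le_cabs_sum (I : Type) (r : seq I) (P : pred I) (F : I -> R[i])
    (G : I -> R) :
  (forall i, P i -> cabs (F i) <= G i) ->
  cabs (\sum_(i <- r | P i) F i) <= \sum_(i <- r | P i) G i.
Proof.
move=> FG; apply: (big_rec2 (fun z x => cabs z <= x)); first by rewrite cabs0.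
move=> i x z Pi zx; apply: le_trans (le_cabsD _ _) _.
by apply: lerD => //; exact: FG.
Qed.

End Cabs.

(** * Lattice shifts, coordinates, and single terms of weighted sums *)

Section Lattice.
Context {d : nat}.
Implicit Types (p : pt d) (k l : 'I_d).

Lemma shiftmK p k : shiftm (shiftp p k) k = p.
Proof. by apply/ffunP => i; rewrite !ffunE addrK. Qed.

Lemma coord_le_eucl (R : realType) p k : ((p k)%:~R : R) <= eucl R p.
Proof.
apply: le_trans (ler_norm _) _; rewrite -sqrtr_sqr ler_wsqrtr // (bigD1 k) //=.
by rewrite lerDl sumr_ge0 // => i _; exact: sqr_ge0.
Qed.

Lemma wsum_ge_term (R : realType) (h : R) (w : pt d -> R) (u : pt d -> R[i]) p :
  0 <= h -> (forall q, 0 <= w q) ->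
  ((h ^+ d * w p * cabs2 (u p))%:E <= wsum h w u)%E.
Proof.
move=> h0 w0; apply: esum_ge; exists [set p]%classic.
  by split => //; exact: finite_set1.
by rewrite fsbig_set1.
Qed.

End Lattice.

(** * Propagation of bounds from a half-space, layer by layer *)

Section HalfSpacePropagation.
Variables (R : realType) (d : nat) (h K : R) (u V : pt d -> R[i]) (k : 'I_d).
Hypothesis h_gt0 : 0 < h.
Hypothesis V_le : forall j, cabs (V j) <= K.
Hypothesis u_sol : forall j, dlap h u j + V j * u j = 0.

Let C : R := 4%:R * d%:R + h ^+ 2 * K.

(** Apart from [u (shiftm i k)], the equation at [i] only involves points of the half-space. The
    [d - 1] directions [l != k] cost [4 B] each, direction [k] costs [B + 2 B], and the potential
    [h^2 K B]; the total is at most [C B]. *)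
Lemma dlap_layer_bound (B : R) (i : pt d) :
  (forall p : pt d, i k <= p k -> cabs (u p) <= B) ->
  cabs (u (shiftm i k)) <= C * B.
Proof.
move=> uB.
have iB : cabs (u i) <= B by apply: uB.
have B0 : 0 <= B := le_trans (cabs_ge0 _) iB.
pose T l := u (shiftp i l) - 2%:R * u i + u (shiftm i l).
have two : cabs (- (2%:R * u i)) <= 2%:R * B.
  rewrite mulr_natl mulr2n cabsN; apply: le_trans (le_cabsD _ _) _.
  by rewrite mulr_natl mulr2n lerD.
have pB l : cabs (u (shiftp i l)) <= B by apply: uB; rewrite ffunE lerDl.
have T_le l : l != k -> cabs (T l) <= 4%:R * B.
  move=> lk; have mB : cabs (u (shiftm i l)) <= B.
    by apply: uB; rewrite ffunE eq_sym (negbTE lk) subr0.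
  have := le_cabsD (u (shiftp i l) - 2%:R * u i) (u (shiftm i l)).
  have := le_cabsD (u (shiftp i l)) (- (2%:R * u i)).
  by have := pB l; rewrite /T; lra.
have hh : ((h ^+ 2)%:C * (h ^- 2)%:C = 1 :> R[i])%C.
  by rewrite -rmorphM /= mulfV ?rmorph1 // expf_neq0 // gt_eqF.
have sumT : \sum_l T l = - ((h ^+ 2)%:C%C * (V i * u i)).
  have /(congr1 (fun z => (h ^+ 2)%:C%C * z)) := u_sol i.
  rewrite mulr0 mulrDr /dlap mulrA hh mul1r => /eqP.
  by rewrite addr_eq0 => /eqP.
have -> : u (shiftm i k) =
    - ((h ^+ 2)%:C%C * (V i * u i)) + - (\sum_(l | l != k) T l)
    + (- u (shiftp i k) + - - (2%:R * u i)).
  by rewrite -sumT (bigD1 k) //= /T; ring.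
apply: le_trans (le_cabsD _ _) _.
apply: le_trans (lerD (le_cabsD _ _) (le_cabsD _ _)) _.
rewrite !cabsN !cabsM cabs_real ger0_norm ?sqr_ge0 //.
have sT : cabs (\sum_(l | l != k) T l) <= \sum_(l < d | l != k) (4%:R * B).
  exact: le_cabs_sum.
(* The [d - 1] remaining directions are counted as the full sum minus its [k]-th term. *)
have sB : \sum_(l < d | l != k) (4%:R * B) = 4%:R * d%:R * B - 4%:R * B.
  have : \sum_(l < d) (4%:R * B) = 4%:R * d%:R * B.
    by rewrite sumr_const card_ord mulrAC mulr_natr.
  by rewrite (bigD1 k) //= => <-; rewrite [RHS]addrC addKr.
have VuB : h ^+ 2 * (cabs (V i) * cabs (u i)) <= h ^+ 2 * (K * B).
  by rewrite ler_wpM2l ?sqr_ge0 // ler_pM ?cabs_ge0.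
move: two; rewrite cabsN cabsM => two.
have := pB k; rewrite /C mulrDl -(mulrA (h ^+ 2)).
move: sT; rewrite sB; lra.
Qed.

Lemma half_space_growth (m : int) (B : R) (n : nat) :
  (forall p : pt d, m <= p k -> cabs (u p) <= B) ->
  forall p : pt d, m - n%:Z <= p k -> cabs (u p) <= C ^+ n * B.
Proof.
move=> uB; elim: n => [|n IHn] p.
  by rewrite subr0 expr0 mul1r; exact: uB.
move=> mp; rewrite -(shiftmK p k) exprS -mulrA; apply: dlap_layer_bound => q.
rewrite ffunE eqxx => pq; apply: IHn.
by apply: le_trans pq; rewrite -lerBlDr -addrA -opprD (addrC n%:Z) -intS.
Qed.

Lemma superexponential_decay_eq0 :
  (forall A : R, exists N D : R, forall p : pt d, N <= eucl R p ->
     cabs (u p) <= D * expR (- (A * eucl R p))) ->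
  forall j, u j = 0.
Proof.
move=> decay j; apply: cabs_eq0; apply/eqP; rewrite eq_le cabs_ge0 andbT.
have C0 : 0 <= C.
  have K0 : 0 <= K := le_trans (cabs_ge0 _) (V_le j).
  by rewrite addr_ge0 // mulr_ge0 // sqr_ge0.
(* In the rate [C + 1], the part [C] absorbs [C ^+ n <= expR (n * C)], and the extra 1 leaves a
   factor [expR (- n)] that beats [n]. All dependence on [n] then cancels, which gives [E]. *)
have [N [D uD]] := decay (C + 1).
pose E := `|D| * expR (- ((C + 1) * (j k)%:~R)).
have key (n : nat) : N <= (j k + n%:Z)%:~R -> cabs (u j) * n%:R <= E.
  move=> Nn; set m := j k + n%:Z.
  have um (p : pt d) : m <= p k ->
      cabs (u p) <= `|D| * expR (- ((C + 1) * m%:~R)).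
    move=> mp; have me : m%:~R <= eucl R p.
      by apply: le_trans (coord_le_eucl R p k); rewrite ler_int.
    apply: le_trans (uD _ (le_trans Nn me)) _.
    (* The sign of [D] is unknown; with [|D|] the bound is monotone in the exponential. *)
    apply: (le_trans (ler_wpM2r (expR_ge0 _) (ler_norm D))).
    by rewrite ler_wpM2l // ler_expR lerN2 ler_wpM2l // addr_ge0.
  have jm : m - n%:Z <= j k by rewrite /m addrK.
  have Cn : C ^+ n * n%:R <= expR (n%:R * C) * expR n%:R.
    apply: ler_pM; rewrite ?exprn_ge0 ?ler0n //.
      rewrite expRM_natl lerXn2r ?nnegrE ?expR_ge0 //.
      by apply: le_trans (expR_ge1Dx C); rewrite lerDr.
    by apply: le_trans (expR_ge1Dx n%:R); rewrite lerDr.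
  have -> : E = expR (n%:R * C) * expR n%:R *
      (`|D| * expR (- ((C + 1) * m%:~R))).
    rewrite mulrCA -!expRD /E /m; congr (_ * expR _).
    by rewrite rmorphD /= -pmulrn; ring.
  apply: le_trans (ler_wpM2r (ler0n _ n) (half_space_growth m _ n um j jm)) _.
  by rewrite mulrAC ler_wpM2r // mulr_ge0 // expR_ge0.
rewrite leNgt; apply/negP => a0.
have E0 : 0 <= E / cabs (u j) by rewrite divr_ge0 ?mulr_ge0 ?expR_ge0 // ltW.
(* An integer above [x] both moves the half-space beyond [N] and violates [cabs (u j) * n <= E]. *)
pose x := `|N - (j k)%:~R| + E / cabs (u j).
have xn : x < (Num.bound x)%:R by apply: archi_boundP; rewrite addr_ge0.
have := ler_norm (N - (j k)%:~R); have := normr_ge0 (N - (j k)%:~R).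
set y := `|_| in x xn * => y0 Ny.
have : E / cabs (u j) < (Num.bound x)%:R by move: xn; rewrite {1}/x; lra.
rewrite ltr_pdivrMr // mulrC ltNge => /negP; apply; apply: key.
by rewrite rmorphD /= -pmulrn; move: xn; rewrite {1}/x; lra.
Qed.

End HalfSpacePropagation.

(** Each single term is bounded by the finite sum, so [cabs2 (u p)] is at most a constant times
    [expR (- g (eucl R p))]. For fixed [h] the logarithm makes [g] eventually exceed any linear
    function. *)
Lemma wsum_xlnx_eq0 (R : realType) (d : nat) (k : 'I_d) (h K c : R)
    (g : R -> R) (u V : pt d -> R[i]) :
  0 < h -> 0 < c ->
  (forall t, 1 <= h * t -> c * (h * t) * ln (h * t) <= g t) ->
  (forall j, cabs (V j) <= K) ->
  (forall j, dlap h u j + V j * u j = 0) ->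
  (wsum h (fun j => expR (g (eucl R j))) u < +oo)%E ->
  forall j, u j = 0.
Proof.
move=> h0 c0 gP VK usol ufin.
apply: (superexponential_decay_eq0 R d h K u V k h0 VK usol) => A.
(* Once [ln (h * t) >= a], the lower bound on [g] reaches [2 A t]; the 2 is there because the sum
   controls the square of the modulus. The absolute value ensures [expR a >= 1], hence [h * t >= 1],
   as [gP] demands. *)
pose a := `|2%:R * A / (c * h)|.
have ch0 : 0 < c * h by rewrite mulr_gt0.
have g_ge t : expR a / h <= t -> 2%:R * (A * t) <= g t.
  rewrite ler_pdivrMr // mulrC => at_.
  have ht0 : 0 < h * t by apply: lt_le_trans at_; exact: expR_gt0.
  have t0 : 0 < t by rewrite -(pmulr_rgt0 t h0).
  have ln_ge : a <= ln (h * t) by rewrite -(expRK a) ler_ln ?posrE ?expR_gt0.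
  apply: le_trans (gP t _); last first.
    apply: le_trans at_; apply: le_trans (expR_ge1Dx a).
    by rewrite lerDl normr_ge0.
  have : 2%:R * A / (c * h) <= ln (h * t) := le_trans (ler_norm _) ln_ge.
  rewrite ler_pdivrMr // => /(ler_wpM2r (ltW t0)); lra.
pose S := fine (wsum h (fun j => expR (g (eucl R j))) u).
have wS p : h ^+ d * expR (g (eucl R p)) * cabs2 (u p) <= S.
  have w_ge := wsum_ge_term R h _ u p (ltW h0)
    (fun q => expR_ge0 (g (eucl R q))).
  rewrite -lee_fin /S fineK // ge0_fin_numE //; apply: le_trans w_ge.
  by rewrite lee_fin cabs2E !mulr_ge0 ?expR_ge0 ?cabs_ge0 ?exprn_ge0 ?(ltW h0).
have hd0 : 0 < h ^+ d by rewrite exprn_gt0.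
exists (expR a / h), (Num.sqrt (S / h ^+ d)) => p /g_ge Ag.
have S0 : 0 <= S.
  by apply: le_trans (wS p); rewrite !mulr_ge0 ?expR_ge0 ?(ltW hd0) //
    cabs2E sqr_ge0.
rewrite -(@ler_pXn2r _ 2) ?nnegrE ?cabs_ge0 ?mulr_ge0 ?sqrtr_ge0 ?expR_ge0 //.
rewrite -cabs2E exprMn sqr_sqrtr ?divr_ge0 ?(ltW hd0) // -expRM_natl.
rewrite mulrN expRN -mulrA -invfM ler_pdivlMr ?mulr_gt0 ?expR_gt0 //.
apply: le_trans (wS p); rewrite mulrC ler_wpM2r ?cabs2E ?sqr_ge0 //.
by rewrite ler_wpM2l ?(ltW hd0) // ler_expR.
Qed.

(** Factor out [x] and use [expR y >= 1 + y] at [y = s * ln x]. *)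
Lemma powR_ge_xlnx (R : realType) (x s : R) :
  1 <= x -> 0 <= s -> s * x * ln x <= x `^ (1 + s).
Proof.
move=> x1 s0; have x0 : 0 < x by exact: lt_le_trans ltr01 x1.
rewrite powRD ?(gt_eqF x0) ?implybT // powRr1 ?(ltW x0) // mulrAC mulrC.
rewrite ler_pM2l //.
by rewrite /powR gt_eqF //; apply: le_trans (expR_ge1Dx _); rewrite lerDr.
Qed.

Theorem theorem1p2 (R : realType) (d : nat) (hd : (0 < d)%N) :
  (* Part 1 *)
  (exists mu0 : R, 0 < mu0 /\
    forall (u V : R -> pt d -> R[i]) (K M : R),
      (forall h, 0 < h -> forall j, cabs (V h j) <= K) ->
      (forall h, 0 < h -> (l2sq h (u h) <= K%:E)%E) ->
      (forall h, 0 < h -> forall j, dlap h (u h) j + V h j * u h j = 0) ->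
      (forall h, 0 < h ->
         (wsum h (fun j => expR (mu0 * (h * eucl R j) `^ (4%:R / 3%:R))) (u h)
           <= M%:E)%E) ->
      exists h0 : R, 0 < h0 /\ forall h, 0 < h -> h < h0 -> forall j, u h j = 0)
  /\
  (* Part 2 *)
  (exists mu0 : R, 0 < mu0 /\
    forall (beta : R), 3%:R < beta ->
    forall (u V : R -> pt d -> R[i]) (K M : R),
      (forall h, 0 < h -> forall j, cabs (V h j) <= K) ->
      (forall h, 0 < h -> (l2sq h (u h) <= K%:E)%E) ->
      (forall h, 0 < h -> forall j, dlap h (u h) j + V h j * u h j = 0) ->
      (forall h, 0 < h ->
         (wsum h (fun j => expR (mu0 * (h * eucl R j) `^ (1 + beta^-1)
                                     * ln (h * eucl R j))) (u h)
           <= M%:E)%E) ->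
      exists h0 : R, 0 < h0 /\ forall h, 0 < h -> h < h0 -> forall j, u h j = 0)
  /\
  (* Part 3 *)
  (exists mu0 : R, 0 < mu0 /\
    forall (h : R), 0 < h ->
    forall (u V : pt d -> R[i]) (K : R),
      (forall j, cabs (V j) <= K) ->
      (l2sq h u < +oo)%E ->
      (forall j, dlap h u j + V j * u j = 0) ->
      (wsum h (fun j => expR (mu0 * eucl R j * ln (eucl R j * h))) u < +oo)%E ->
      forall j, u j = 0).
Proof.
(* Positivity of [d] supplies a coordinate direction along which to propagate. *)
pose k := Ordinal hd.
split; [|split].
(* Writing [4/3 = 1 + 1/3] gives the constant [c = 1/3]. *)
- exists 1; split=> // u V K M VK _ usol uM; exists 1; split=> // h h0 _.
  apply: (@wsum_xlnx_eq0 _ _ k _ K (3%:R^-1)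
    (fun t => 1 * (h * t) `^ (4%:R / 3%:R)) _ _ h0 _ _ (VK h h0) (usol h h0)).
  + by rewrite invr_gt0 ltr0n.
  + move=> t ht; rewrite mul1r.
    have -> : 4%:R / 3%:R = 1 + 3%:R^-1 :> R by field.
    by apply: powR_ge_xlnx => //; rewrite invr_ge0 ler0n.
  + by apply: le_lt_trans (uM h h0) _; exact: ltry.
- exists 1; split=> // beta beta3 u V K M VK _ usol uM.
  exists 1; split=> // h h0 _.
  apply: (@wsum_xlnx_eq0 _ _ k _ K 1
    (fun t => 1 * (h * t) `^ (1 + beta^-1) * ln (h * t))
    _ _ h0 _ _ (VK h h0) (usol h h0)) => //.
  (* For [h * t >= 1] the power [1 + beta^-1] dominates the first power, so [c = 1] works. *)
  + move=> t ht; rewrite !mul1r ler_wpM2r ?ln_ge0 //.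
    have b0 : 0 <= beta^-1 by rewrite invr_ge0 (le_trans _ (ltW beta3)).
    have ht0 : 0 < h * t by exact: lt_le_trans ltr01 ht.
    rewrite -{1}(powRr1 (ltW ht0)) ler_powR //.
    by rewrite lerDl.
  + by apply: le_lt_trans (uM h h0) _; exact: ltry.
- exists 1; split=> // h h0 u V K VK _ usol ufin.
  (* The weight carries [|j|] rather than [|hj|] before the logarithm; [c = h^-1] compensates
     exactly. *)
  apply: (@wsum_xlnx_eq0 _ _ k h K h^-1
    (fun t => 1 * t * ln (t * h)) u V h0 _ _ VK usol ufin).
  + by rewrite invr_gt0.
  + by move=> t ht; rewrite mulKf ?gt_eqF // mul1r (mulrC t h).
Qed.
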